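(* Let $n\ge 2$ and let $X$ be an arbitrary subset of $[-1,1]$. Then $\alpha_X(n)=\alpha_{\overline{X}}(n)$, where $\overline{X}$ denotes the topological closure of $X$ in $[-1,1]$. In particular, $\alpha_X(n)=0$ if $1\in\overline{X}$.
   Context: $S^{n-1}=\{x\in\mathbb{R}^n:\langle x,x\rangle=1\}$ is the unit sphere, with $\langle\cdot,\cdot\rangle$ the standard inner product, and $\lambda$ is the Lebesgue surface measure on $S^{n-1}$, normalised so that $\lambda(S^{n-1})=1$. For $X\subset[-1,1]$, a subset $I\subset S^{n-1}$ is called $X$-avoiding if $\langle\xi,\eta\rangle\notin X$ for all $\xi,\eta\in I$ (including $\xi=\eta$). Define $$\alpha_X(n):=\sup\{\lambda(I): I\subset S^{n-1}\text{ is Lebesgue measurable and } X\text{-avoiding}\}.$$ *)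

(* Defs.v *)
From mathcomp Require Import all_boot all_order all_algebra.
From mathcomp Require Import all_classical all_reals all_analysis.

Set Implicit Arguments.
Unset Strict Implicit.
Unset Printing Implicit Defensive.

Import Order.TTheory GRing.Theory Num.Theory.
Import numFieldNormedType.Exports.

Local Open Scope classical_set_scope.
Local Open Scope ring_scope.

Definition dot (R : realType) (n : nat) (x y : 'rV[R]_n) : R :=
  \sum_(i < n) x 0 i * y 0 i.

Definition sphere (R : realType) (n : nat) : set 'rV[R]_n :=
  [set x | dot x x = 1].

(* The norm `|x| on 'rV[R]_n is the sup norm, hence an explicit Euclidean
   distance. *)
Definition edist (R : realType) (n : nat) (x y : 'rV[R]_n) : R :=
  Num.sqrt (dot (x - y) (x - y)).

(* 0 is added to the set so that diam set0 = 0 and not -oo. *)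
Definition diam (R : realType) (n : nat) (A : set 'rV[R]_n) : \bar R :=
  ereal_sup (0%E |` [set (edist x y)%:E | x in A & y in A]).

Definition hausdorff_pre (R : realType) (n m : nat) (delta : R)
    (A : set 'rV[R]_n) : \bar R :=
  ereal_inf [set (\sum_(0 <= k <oo) diam (F k) ^+ m)%E |
    F in [set F : (set 'rV[R]_n)^nat |
      A `<=` \bigcup_k F k /\ forall k, (diam (F k) <= delta%:E)%E]].

(* m-dimensional Hausdorff outer measure on R^n for the Euclidean distance, for
   m >= 1, without the usual dimensional constant, which cancels in
   sphere_measure. *)
Definition hausdorff (R : realType) (n m : nat) (A : set 'rV[R]_n) : \bar R :=
  ereal_sup [set hausdorff_pre m delta A | delta in [set d : R | 0 < d]].

(* The surface measure on the sphere is the (n-1)-dimensional Hausdorff measure,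
   here divided by the total mass. *)
Definition sphere_measure (R : realType) (n : nat) (A : set 'rV[R]_n) : \bar R :=
  (hausdorff n.-1 A * (fine (hausdorff n.-1 (@sphere R n)))^-1%:E)%E.

(* For subsets of the sphere, Caratheodory measurability is measurability for
   the completion of the Borel surface measure. *)
Definition sphere_measurable (R : realType) (n : nat) (A : set 'rV[R]_n) : Prop :=
  A `<=` @sphere R n /\ (@hausdorff R n n.-1).-caratheodory A.

Definition avoiding (R : realType) (n : nat) (X : set R) (A : set 'rV[R]_n) :
    Prop :=
  forall x y, A x -> A y -> ~ X (dot x y).

Definition alpha (R : realType) (n : nat) (X : set R) : \bar R :=
  ereal_sup [set @sphere_measure R n A |
    A in [set A | sphere_measurable A /\ avoiding X A]].

(* Main.v *)
(* Let I be measurable and X-avoiding, S the sphere, H its Hausdorff measure. By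
   outer regularity of H and a maximal packing by balls of one small radius r,
   all of I but a part of small measure is a measurable set J such that, at each
   x in J, the complement of I fills at most a small fraction c of the cap of
   radius r. Doubling of H on caps makes the choice of r uniform in x.
   J avoids the closure of X: if x, y are in J and t in X is close to <x, y>,
   there is a map F with <z, F z> = t on the sphere, bi-Lipschitz near x with
   absolute constants and with F x close to y (a rotation of the polar angle
   around a suitable pole). For c small enough some z near x satisfies both
   z in I and F z in I, so that X meets the inner products of I.
   If H S is 0 or infinite, sphere_measure vanishes identically, so neither the
   positivity nor the finiteness of H S has to be established. *)
Require Import Defs.
From HB Require Import structures.
From mathcomp Require Import all_boot all_order all_algebra.
From mathcomp Require Import all_classical all_reals all_analysis.
From mathcomp Require Import ring lra.

Import Order.TTheory GRing.Theory Num.Theory.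
Import numFieldNormedType.Exports.
(* Shadows the edist of MathComp-Analysis. *)
Import Defs.

Set Implicit Arguments.
Unset Strict Implicit.
Unset Printing Implicit Defensive.

Local Open Scope classical_set_scope.
Local Open Scope ring_scope.

(** * Euclidean geometry *)

Section euclid.
Context (R : realType) (n : nat).
Implicit Types (x y z : 'rV[R]_n) (a b r : R).

Lemma dotC x y : dot x y = dot y x.
Proof. by apply: eq_bigr => i _; rewrite mulrC. Qed.

Lemma dotDl x y z : dot (x + y) z = dot x z + dot y z.
Proof. by rewrite -big_split; apply: eq_bigr => i _; rewrite mxE mulrDl. Qed.

Lemma dotZl a x y : dot (a *: x) y = a * dot x y.
Proof. by rewrite mulr_sumr; apply: eq_bigr => i _; rewrite mxE mulrA. Qed.

Lemma dotNl x y : dot (- x) y = - dot x y.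
Proof. by rewrite -scaleN1r dotZl mulN1r. Qed.

Lemma dotBl x y z : dot (x - y) z = dot x z - dot y z.
Proof. by rewrite dotDl dotNl. Qed.

Lemma dotDr x y z : dot x (y + z) = dot x y + dot x z.
Proof. by rewrite dotC dotDl !(dotC _ x). Qed.

Lemma dotZr a x y : dot x (a *: y) = a * dot x y.
Proof. by rewrite dotC dotZl dotC. Qed.

Lemma dotNr x y : dot x (- y) = - dot x y.
Proof. by rewrite dotC dotNl dotC. Qed.

Lemma dotBr x y z : dot x (y - z) = dot x y - dot x z.
Proof. by rewrite dotDr dotNr. Qed.

Definition dotE := (dotDl, dotDr, dotBl, dotBr, dotNl, dotNr, dotZl, dotZr).

Lemma dot_ge0 x : 0 <= dot x x.
Proof. by apply: sumr_ge0 => i _; rewrite -expr2 sqr_ge0. Qed.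

Lemma dot_eq0 x : (dot x x == 0) = (x == 0).
Proof.
rewrite psumr_eq0 => [|i _]; last by rewrite -expr2 sqr_ge0.
apply/allP/eqP => [h|-> i _] /=; last by rewrite mxE mul0r.
apply/rowP => i; rewrite mxE; apply/eqP.
by have := h i (mem_index_enum _); rewrite /= -expr2 sqrf_eq0.
Qed.

Lemma Cauchy_Schwarz x y : dot x y ^+ 2 <= dot x x * dot y y.
Proof.
have [/eqP|y0] := eqVneq (dot y y) 0.
  by rewrite dot_eq0 => /eqP ->; rewrite -(scale0r x) !dotE !mul0r expr0n mulr0.
have yy : 0 < dot y y by rewrite lt_def y0 dot_ge0.
(* This squared norm equals [dot y y * (dot x x * dot y y - dot x y ^+ 2)]. *)
have := dot_ge0 (dot y y *: x - dot x y *: y).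
rewrite !dotE (dotC y x) => h.
rewrite -subr_ge0 -(pmulr_rge0 _ yy); nra.
Qed.

Lemma edist_ge0 x y : 0 <= edist x y. Proof. exact: sqrtr_ge0. Qed.

Lemma sqr_edist x y : edist x y ^+ 2 = dot (x - y) (x - y).
Proof. by rewrite sqr_sqrtr// dot_ge0. Qed.

Lemma edistxx x : edist x x = 0.
Proof. by rewrite /edist subrr -(scale0r 0) dotZl mul0r sqrtr0. Qed.

Lemma edistC x y : edist x y = edist y x.
Proof. by congr Num.sqrt; rewrite -opprB dotNl dotNr opprK. Qed.

Lemma edist_lt x y r : 0 <= r -> (edist x y < r) = (dot (x - y) (x - y) < r ^+ 2).
Proof. by move=> r0; rewrite -sqr_edist ltr_pXn2r// nnegrE edist_ge0. Qed.

Lemma edist_le x y r :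
  0 <= r -> (edist x y <= r) = (dot (x - y) (x - y) <= r ^+ 2).
Proof. by move=> r0; rewrite -sqr_edist ler_pXn2r// nnegrE edist_ge0. Qed.

(** Cauchy-Schwarz for differences; a single vector is covered by taking [w] to be 0. *)
Lemma dot_le_edist x y z w : dot (x - y) (z - w) <= edist x y * edist z w.
Proof.
apply: le_trans (ler_norm _) _.
rewrite -(@ler_pXn2r _ 2%N)// ?nnegrE ?mulr_ge0 ?edist_ge0//.
by rewrite real_normK ?num_real// exprMn !sqr_edist Cauchy_Schwarz.
Qed.

Lemma edist_triangle y x z : edist x z <= edist x y + edist y z.
Proof.
rewrite edist_le ?addr_ge0 ?edist_ge0//.
have -> : x - z = (x - y) + (y - z) by rewrite addrA subrK.
move: (dot_le_edist x y y z); rewrite sqrrD !sqr_edist.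
move: (x - y) (y - z) => u v uv; rewrite !dotE (dotC v u).
by lra.
Qed.

Lemma edistNN x y : edist (- x) (- y) = edist x y.
Proof. by rewrite /edist -opprD dotNl dotNr opprK. Qed.

Lemma coord_le_edist x y i : `|x 0 i - y 0 i| <= edist x y.
Proof.
rewrite -(@ler_pXn2r _ 2%N)// ?nnegrE ?edist_ge0// sqr_edist real_normK ?num_real//.
rewrite {1}/dot (bigD1 i)//= !mxE -expr2 lerDl.
by apply: sumr_ge0 => j _; rewrite -expr2 sqr_ge0.
Qed.

Lemma edist_sphere x y :
  sphere x -> sphere y -> edist x y ^+ 2 = 2 - 2 * dot x y.
Proof.
by rewrite /sphere/= => x1 y1; rewrite sqr_edist !dotE x1 y1 (dotC y); lra.
Qed.

Lemma dot_sphere_le1 x y : sphere x -> sphere y -> dot x y <= 1.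
Proof. by move=> /edist_sphere h /h; have := sqr_ge0 (edist x y); lra. Qed.

Lemma sphereN x : sphere x -> sphere (- x).
Proof. by rewrite /sphere/= !dotE opprK. Qed.

Definition eball x r : set 'rV[R]_n := [set y | edist x y < r].

(** Openness is stated with Euclidean balls, which avoids comparing them with the sup norm topology
    of ['rV[R]_n]. *)
Definition eopen (U : set 'rV[R]_n) :=
  forall x, U x -> exists2 r, 0 < r & eball x r `<=` U.

Lemma le_eball x r s : r <= s -> eball x r `<=` eball x s.
Proof. by move=> rs y /lt_le_trans; exact. Qed.

Lemma eball_center x r : 0 < r -> eball x r x.
Proof. by rewrite /eball/= edistxx. Qed.

Lemma eopen_eball x r : eopen (eball x r).
Proof.
move=> y /= xy; exists (r - edist x y); first by rewrite subr_gt0.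
move=> z; rewrite /eball/= => yz.
by have := edist_triangle y x z; lra.
Qed.

Lemma eopen_bigcup (F : (set 'rV[R]_n)^nat) :
  (forall k, eopen (F k)) -> eopen (\bigcup_k F k).
Proof.
move=> Fo x [k _ Fkx]; have [r r0 h] := Fo k x Fkx.
by exists r => // y /h ?; exists k.
Qed.

Lemma eopenI (U V : set 'rV[R]_n) : eopen U -> eopen V -> eopen (U `&` V).
Proof.
move=> oU oV x [Ux Vx].
have [r r0 rU] := oU x Ux; have [s s0 sV] := oV x Vx.
exists (Num.min r s); first by rewrite lt_min r0.
by move=> y; rewrite /eball/= lt_min => /andP[? ?]; split; [apply: rU|apply: sV].
Qed.

Lemma eopen_setC_sphere : eopen (~` @sphere R n).
Proof.
move=> x xS.
have dx0 z : dot z z = edist z 0 ^+ 2 by rewrite sqr_edist subr0.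
have d1 z : (dot z z == 1) = (edist z 0 == 1).
  by rewrite dx0 sqrp_eq1// edist_ge0.
have /eqP : dot x x <> 1 by [].
rewrite d1 => x1.
exists `|edist x 0 - 1|; first by rewrite normr_gt0 subr_eq0.
move=> y; rewrite /eball/= => xy /eqP; rewrite d1 => /eqP y1.
have h1 := edist_triangle y x 0; have h2 := edist_triangle x y 0.
move: xy; rewrite ltNge => /negP; apply.
by rewrite (edistC y x) in h2; rewrite ler_norml; apply/andP; split; lra.
Qed.

End euclid.

(** * Rotation of the polar angle *)

Section polar_rotation.
Context (R : realType) (n : nat).
Implicit Types (p x y z e : 'rV[R]_n) (c s : R).

Definition polar_sin p z := Num.sqrt (1 - dot z p ^+ 2).

(* In polar coordinates z = cos phi p + sin phi w around the pole p, this is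
   (phi, w) |-> (phi + theta, w), where c = cos theta and s = sin theta. *)
Definition polar_rot p c s z :=
  (c * dot z p - s * polar_sin p z) *: p +
  ((c * polar_sin p z + s * dot z p) / polar_sin p z) *: (z - dot z p *: p).

Lemma polar_sin_ge0 p z : 0 <= polar_sin p z. Proof. exact: sqrtr_ge0. Qed.

Lemma sqr_polar_sin p z :
  sphere p -> sphere z -> polar_sin p z ^+ 2 = 1 - dot z p ^+ 2.
Proof.
move=> p1 z1; rewrite sqr_sqrtr// subr_ge0.
by rewrite (le_trans (Cauchy_Schwarz _ _))// p1 z1 mulr1.
Qed.

(** [z] and its image lie on one meridian, at polar angles phi and phi + theta, so the angle between
    them is theta. *)
Lemma dot_polar_rot p c s z : sphere p -> sphere z -> 0 < polar_sin p z ->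
  dot z (polar_rot p c s z) = c.
Proof.
move=> p1 z1 b0; have := sqr_polar_sin p1 z1.
rewrite /polar_rot !dotE (z1 : dot z z = 1).
move: (polar_sin p z) (dot z p) b0 => b a b0 hb.
rewrite -expr2 -hb.
transitivity (c * (b ^+ 2 + a ^+ 2)); last by rewrite hb subrK mulr1.
by field; rewrite gt_eqF.
Qed.

Lemma dot_polar_rot2 p c s y z : sphere p -> sphere y -> sphere z ->
  dot (polar_rot p c s y) (polar_rot p c s z) =
  (c * dot y p - s * polar_sin p y) * (c * dot z p - s * polar_sin p z) +
  (c * polar_sin p y + s * dot y p) / polar_sin p y *
  ((c * polar_sin p z + s * dot z p) / polar_sin p z) *
  (dot y z - dot y p * dot z p).
Proof.
rewrite /sphere/= => p1 y1 z1.
by rewrite /polar_rot !dotE p1 (dotC p z); ring.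
Qed.

Lemma sphere_polar_rot p c s z : c ^+ 2 + s ^+ 2 = 1 ->
  sphere p -> sphere z -> 0 < polar_sin p z -> sphere (polar_rot p c s z).
Proof.
move=> cs p1 z1 b0; have := sqr_polar_sin p1 z1.
rewrite /sphere/= dot_polar_rot2// (z1 : dot z z = 1).
move: (polar_sin p z) (dot z p) b0 => b a b0 hb.
rewrite -!expr2 -hb.
transitivity ((c ^+ 2 + s ^+ 2) * (b ^+ 2 + a ^+ 2)).
  by field; rewrite gt_eqF.
by rewrite cs hb subrK mulr1.
Qed.

(* Writing K for the inner product of the angular components, rotation changes
   bb' to b1b1' in edist^2 = 2 - 2 (aa' + bb' K) while it keeps aa' + bb'. *)
Lemma polar_rot_bilip p c s y z : c ^+ 2 + s ^+ 2 = 1 ->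
  sphere p -> sphere y -> sphere z ->
  1 / 2 <= polar_sin p y -> 1 / 2 <= polar_sin p z ->
  1 / 2 <= c * polar_sin p y + s * dot y p ->
  1 / 2 <= c * polar_sin p z + s * dot z p ->
  edist y z <= 2 * edist (polar_rot p c s y) (polar_rot p c s z) /\
  edist (polar_rot p c s y) (polar_rot p c s z) <= 2 * edist y z.
Proof.
move=> cs p1 y1 z1 by_ge bz_ge b1y_ge b1z_ge.
have by0 : 0 < polar_sin p y by lra.
have bz0 : 0 < polar_sin p z by lra.
have hF := sphere_polar_rot cs p1 _ _.
have := edist_sphere (hF _ y1 by0) (hF _ z1 bz0).
have := edist_sphere y1 z1.
rewrite dot_polar_rot2//.
(* Cauchy-Schwarz for the components orthogonal to [p] will give [K <= 1]. *)
have CS := Cauchy_Schwarz (y - dot y p *: p) (z - dot z p *: p).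
move: CS.
rewrite !dotE (p1 : dot p p = 1) (y1 : dot y y = 1) (z1 : dot z z = 1) !(dotC p).
have := sqr_polar_sin p1 y1; have := sqr_polar_sin p1 z1.
have := edist_ge0 y z; have := edist_ge0 (polar_rot p c s y) (polar_rot p c s z).
move: (edist y z) (edist _ _) => d D.
move: by_ge bz_ge b1y_ge b1z_ge by0 bz0.
move: (polar_sin p y) (polar_sin p z) (dot y p) (dot z p) (dot y z).
move=> b b' a a' t b_ge b'_ge b1_ge b1'_ge b0 b'0 D0 d0 hb' hb CS dE DE.
pose K := (t - a * a') / (b * b').
have tE : t = a * a' + b * b' * K.
  by rewrite /K; field; rewrite !gt_eqF.
have K1 : K <= 1.
  have CS' : (b * b' * K) ^+ 2 <= (b * b') ^+ 2.
    rewrite [leRHS]exprMn hb hb'.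
    have -> : b * b' * K = t - a * a' by lra.
    apply: le_trans (le_trans CS _); rewrite le_eqVlt; apply/orP; left; apply/eqP; ring.
  have P0 : 0 < b * b' by rewrite mulr_gt0.
  rewrite leNgt; apply/negP => K1; move: CS'; rewrite leNgt => /negP; apply.
  by rewrite ltr_pXn2r// ?nnegrE; nra.
(* [A], [A'] are the cosines and [B], [B'] the sines of the new polar angles. *)
pose B := c * b + s * a; pose B' := c * b' + s * a'.
pose A := c * a - s * b; pose A' := c * a' - s * b'.
have AB : A ^+ 2 + B ^+ 2 = 1.
  transitivity ((c ^+ 2 + s ^+ 2) * (b ^+ 2 + a ^+ 2)); first by rewrite /A /B; ring.
  by rewrite cs hb subrK mulr1.
have AB' : A' ^+ 2 + B' ^+ 2 = 1.
  transitivity ((c ^+ 2 + s ^+ 2) * (b' ^+ 2 + a' ^+ 2)).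
    by rewrite /A' /B'; ring.
  by rewrite cs hb' subrK mulr1.
have UE : a * a' + b * b' = A * A' + B * B'.
  transitivity ((c ^+ 2 + s ^+ 2) * (a * a' + b * b')); first by rewrite cs mul1r.
  by rewrite /A /A' /B /B'; ring.
have DE' : D ^+ 2 = 2 * (1 - (a * a' + b * b')) + 2 * (B * B') * (1 - K).
  rewrite DE UE -/A -/A' -/B -/B' /K; field; rewrite !gt_eqF//.
have dE' : d ^+ 2 = 2 * (1 - (a * a' + b * b')) + 2 * (b * b') * (1 - K).
  by rewrite dE tE; ring.
have U1 : a * a' + b * b' <= 1.
  have := sqr_ge0 (a - a'); have := sqr_ge0 (b - b'); nra.
have bb1 : b * b' <= 1.
  have := sqr_ge0 (b - b'); have := sqr_ge0 a; have := sqr_ge0 a'; nra.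
have BB1 : B * B' <= 1.
  have := sqr_ge0 (B - B'); have := sqr_ge0 A; have := sqr_ge0 A'; nra.
have bb4 : 1 / 4 <= b * b' by nra.
have BB4 : 1 / 4 <= B * B' by rewrite -/B -/B' in b1_ge b1'_ge; nra.
have K0 : 0 <= 1 - K by lra.
(* Both squared distances are one common nonnegative term plus [1 - K] times [2 * (b * b')] or
   [2 * (B * B')]. Both products lie in [1/4, 1], so the ratio is at most 4. *)
split.
  rewrite -(@ler_pXn2r _ 2%N)// ?nnegrE//; last lra.
  rewrite exprMn dE' DE'; nra.
rewrite -(@ler_pXn2r _ 2%N)// ?nnegrE//; last lra.
rewrite exprMn dE' DE'; nra.
Qed.

Lemma polar_rot_local x e c s : c ^+ 2 + s ^+ 2 = 1 -> 0 <= c -> 0 <= s ->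
  sphere x -> sphere e -> dot x e = 0 ->
  exists F : 'rV[R]_n -> 'rV[R]_n,
  [/\ F x = c *: x + s *: e,
    forall z, sphere z -> edist x z <= 1 / 30 -> sphere (F z) /\ dot z (F z) = c &
    forall y z, sphere y -> sphere z -> edist x y <= 1 / 30 ->
      edist x z <= 1 / 30 ->
      edist y z <= 2 * edist (F y) (F z) /\ edist (F y) (F z) <= 2 * edist y z].
Proof.
move=> cs c0 s0 x1 e1 xe.
have xx : dot x x = 1 by [].
have ee : dot e e = 1 by [].
(* Any pole p with x at an angle phi in ]0, pi/2[ from p would do: phi and
   phi + theta then stay away from 0 and pi, as theta is in [0, pi/2]. *)
pose p := (3 / 5) *: x - (4 / 5) *: e.
have p1 : sphere p.
  by rewrite /sphere/= /p !dotE (dotC e x) xx ee xe; field.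
have xp : dot x p = 3 / 5 by rewrite /p !dotE xx xe; field.
have bx : polar_sin p x = 4 / 5.
  rewrite /polar_sin xp (_ : 1 - _ = (4 / 5) ^+ 2); last by field.
  by rewrite sqrtr_sqr ger0_norm//; lra.
have near z : sphere z -> edist x z <= 1 / 30 ->
    11 / 15 <= polar_sin p z /\ 1 / 2 <= c * polar_sin p z + s * dot z p.
  move=> z1 xz.
  have p0 : edist p 0 = 1 by rewrite /edist subr0 (p1 : dot p p = 1) sqrtr1.
  (* The inner product with [p] is within 1/30 of 3/5, hence in [17/30, 19/30], and the sine is at
     least sqrt(539)/30 > 11/15. As [c + s >= 1], the new sine is at least 17/30. *)
  have := dot_le_edist x z p 0; have := dot_le_edist z x p 0.
  rewrite subr0 !dotBl xp p0 (edistC z) !mulr1 => h1 h2.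
  have := sqr_polar_sin p1 z1; have := polar_sin_ge0 p z.
  move: (polar_sin p z) (dot z p) h1 h2 => b a h1 h2 b0 hb.
  have cs1 : 1 <= c + s by nra.
  have b_ge : 11 / 15 <= b.
    by rewrite leNgt; apply/negP => bl; nra.
  by split=> //; nra.
exists (polar_rot p c s); split.
- rewrite /polar_rot xp bx /p !scalerBr !scalerA.
  apply/rowP => i; rewrite !mxE; move: (x 0 i) (e 0 i) => u v; lra.
- move=> z z1 xz; have [b0 _] := near z z1 xz.
  have b0' : 0 < polar_sin p z by lra.
  by split; [apply: sphere_polar_rot|apply: dot_polar_rot].
move=> y z y1 z1 xy xz.
have [? ?] := near y y1 xy; have [? ?] := near z z1 xz.
by apply: polar_rot_bilip => //; lra.
Qed.

(** A negative [c] reduces to [- c] by the antipodal map: rotate [x] towards [- e] with cosine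
    [- c], then negate. *)
Lemma sphere_rotation x e c s : c ^+ 2 + s ^+ 2 = 1 -> 0 <= s ->
  sphere x -> sphere e -> dot x e = 0 ->
  exists F : 'rV[R]_n -> 'rV[R]_n,
  [/\ F x = c *: x + s *: e,
    forall z, sphere z -> edist x z <= 1 / 30 -> sphere (F z) /\ dot z (F z) = c &
    forall y z, sphere y -> sphere z -> edist x y <= 1 / 30 ->
      edist x z <= 1 / 30 ->
      edist y z <= 2 * edist (F y) (F z) /\ edist (F y) (F z) <= 2 * edist y z].
Proof.
move=> cs s0 x1 e1 xe; have [c0|c0] := leP 0 c; first exact: polar_rot_local.
have [|||F [Fx F1 Fd]] := @polar_rot_local x (- e) (- c) s _ _ s0 x1 (sphereN e1).
- by rewrite sqrrN.
- lra.
- by rewrite dotNr xe oppr0.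
exists (fun z => - F z); split.
- by rewrite Fx scaleNr scalerN -opprD opprK.
- move=> z z1 xz; have [h1 h2] := F1 z z1 xz; split; first exact: sphereN.
  by rewrite dotNr h2 opprK.
by move=> y z *; rewrite edistNN; exact: Fd.
Qed.

End polar_rotation.

(** * Orthogonal vectors, great circles and reflections *)

Section sphere_geometry.
Context (R : realType) (n : nat).
Implicit Types (x y z e : 'rV[R]_n).

Lemma sphere_normalize v :
  v != 0 -> sphere ((Num.sqrt (dot v v))^-1 *: v : 'rV[R]_n).
Proof.
move=> v0; rewrite /sphere/= !dotE -[X in _ * (_ * X)]sqr_sqrtr ?dot_ge0//.
have : Num.sqrt (dot v v) != 0 by rewrite sqrtr_eq0 -ltNge lt_def dot_eq0 v0 dot_ge0.
by move=> h; field.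
Qed.

Lemma exists_orthogonal x : (2 <= n)%N -> exists2 e, sphere e & dot x e = 0.
Proof.
move=> n2; pose i0 := Ordinal (ltnW n2); pose i1 := Ordinal n2.
have i01 : (i0 == i1) = false by [].
have [d dotd dd] : exists2 d : 'I_n -> 'rV[R]_n,
    forall i y, dot y (d i) = y 0 i & forall i j, d i 0 j = (i == j)%:R.
  exists (fun i => delta_mx 0 i) => [i y|i j]; last by rewrite mxE eqxx (eq_sym i).
  rewrite /dot (bigD1 i)//= mxE !eqxx mulr1 big1 ?addr0// => j ji.
  by rewrite mxE eqxx (negbTE ji) mulr0.
(* A quarter turn of the first two coordinates of [x]. If it vanishes, these coordinates are 0 and
   [d i0] is orthogonal to [x]. *)
pose v := x 0 i1 *: d i0 - x 0 i0 *: d i1.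
have xv : dot x v = 0 by rewrite dotBr !dotZr !dotd mulrC subrr.
have [v0|v0] := eqVneq v 0; last first.
  exists ((Num.sqrt (dot v v))^-1 *: v); first exact: sphere_normalize.
  by rewrite dotZr xv mulr0.
exists (d i0); first by rewrite /sphere/= dotd dd eqxx.
rewrite dotd; have /rowP/(_ i1) := v0; rewrite !mxE !dd eqxx i01 mulr0 mulr1 add0r.
by move=> /eqP; rewrite oppr_eq0 => /eqP.
Qed.

Lemma sphere_decomposition x y : (2 <= n)%N -> sphere x -> sphere y ->
  exists e, [/\ sphere e, dot x e = 0 &
    y = dot x y *: x + Num.sqrt (1 - dot x y ^+ 2) *: e].
Proof.
move=> n2 x1 y1; have xx : dot x x = 1 by [].
have yy : dot y y = 1 by [].
pose v := y - dot x y *: x.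
have xv : dot x v = 0 by rewrite /v dotBr dotZr xx mulr1 subrr.
have vv : dot v v = 1 - dot x y ^+ 2.
  by rewrite {1}/v dotBl dotZl xv mulr0 subr0 /v dotBr yy dotZr (dotC y); ring.
(* If [y] is [x] or [- x], the coefficient of [e] is 0 and any unit vector orthogonal to [x] will
   do. *)
have [v0|v0] := eqVneq v 0.
  have [e e1 xe] := exists_orthogonal x n2; exists e; split=> //.
  move: vv; rewrite v0 -(scale0r 0) dotZl mul0r => <-.
  by rewrite sqrtr0 scale0r addr0; apply/eqP; rewrite -subr_eq0 -/v v0.
exists ((Num.sqrt (dot v v))^-1 *: v); split.
- exact: sphere_normalize.
- by rewrite dotZr xv mulr0.
have : Num.sqrt (dot v v) != 0 by rewrite sqrtr_eq0 -ltNge lt_def dot_eq0 v0 dot_ge0.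
by rewrite -vv => h; rewrite scalerA divff// scale1r addrC subrK.
Qed.

(* Rotates x along the great circle through y until the inner product is t. *)
Lemma sphere_rotation_near x y (t : R) : (2 <= n)%N ->
  sphere x -> sphere y -> t ^+ 2 <= 1 ->
  exists F : 'rV[R]_n -> 'rV[R]_n,
  [/\ edist (F x) y ^+ 2 <= 4 * `|t - dot x y|,
    forall z, sphere z -> edist x z <= 1 / 30 -> sphere (F z) /\ dot z (F z) = t &
    forall y z, sphere y -> sphere z -> edist x y <= 1 / 30 ->
      edist x z <= 1 / 30 ->
      edist y z <= 2 * edist (F y) (F z) /\ edist (F y) (F z) <= 2 * edist y z].
Proof.
move=> n2 x1 y1 t1.
have [e [e1 xe yE]] := sphere_decomposition n2 x1 y1.
have u1 : dot x y ^+ 2 <= 1.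
  by rewrite (le_trans (Cauchy_Schwarz _ _))// x1 y1 mulr1.
have xx : dot x x = 1 by [].
have ee : dot e e = 1 by [].
have hs : Num.sqrt (1 - t ^+ 2) ^+ 2 = 1 - t ^+ 2 by rewrite sqr_sqrtr// subr_ge0.
have hr : Num.sqrt (1 - dot x y ^+ 2) ^+ 2 = 1 - dot x y ^+ 2.
  by rewrite sqr_sqrtr// subr_ge0.
have [|F [Fx F1 Fd]] := @sphere_rotation _ _ x e t _ _ (sqrtr_ge0 (1 - t ^+ 2)) x1 e1 xe.
  by rewrite hs addrC subrK.
exists F; split=> //.
rewrite sqr_edist Fx {1 2}yE opprD addrACA -!scalerBl !dotE.
rewrite (dotC e x) xx ee xe.
move: (sqrtr_ge0 (1 - t ^+ 2)) (sqrtr_ge0 (1 - dot x y ^+ 2)) hs hr.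
move: (Num.sqrt (1 - t ^+ 2)) (Num.sqrt (1 - dot x y ^+ 2)) => s r s0 r0.
move: (dot x y) u1 => u u1 hs hr.
have tu : (t - u) ^+ 2 <= 2 * `|t - u| /\ `|t ^+ 2 - u ^+ 2| <= 2 * `|t - u|.
  have [t1l t1r] : -1 <= t /\ t <= 1 by split; nra.
  have [u1l u1r] : -1 <= u /\ u <= 1 by split; nra.
  split.
    rewrite -real_normK ?num_real// expr2; apply: ler_wpM2r => //.
    by rewrite ler_norml; apply/andP; split; lra.
  rewrite subr_sqr normrM mulrC; apply: ler_wpM2r => //.
  by rewrite ler_norml; apply/andP; split; lra.
(* [|s - r| <= s + r], both being nonnegative, and [s ^+ 2 - r ^+ 2 = u ^+ 2 - t ^+ 2]. This keeps
   the bound linear in [|t - u|] although the square root is not Lipschitz at 0. *)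
have sr : (s - r) ^+ 2 <= `|t ^+ 2 - u ^+ 2|.
  have -> : `|t ^+ 2 - u ^+ 2| = `|s - r| * (s + r).
    rewrite -[X in _ = _ * X]ger0_norm ?addr_ge0// -normrM -subr_sqr hs hr.
    by rewrite -[LHS]normrN; congr `|_|; ring.
  rewrite -real_normK ?num_real// expr2; apply: ler_wpM2l => //.
  by rewrite ler_norml; apply/andP; split; lra.
case: tu; lra.
Qed.

Definition reflection u z : 'rV[R]_n := z - (2 * dot z u / dot u u) *: u.

Lemma dot_reflection u z :
  u != 0 -> dot (reflection u z) (reflection u z) = dot z z.
Proof.
rewrite -dot_eq0 => u0.
by rewrite /reflection !dotBl !dotBr !dotZl !dotZr (dotC u z); field.
Qed.

Lemma reflectionB u z w : reflection u (z - w) = reflection u z - reflection u w.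
Proof.
by rewrite /reflection dotBl; apply/rowP => i; rewrite !mxE; ring.
Qed.

(** The reflection along [x - y] is an isometry fixing the origin, and it exchanges [x] and [y]
    because they have equal norms. *)
Lemma sphere_transitive x y : sphere x -> sphere y ->
  exists T : 'rV[R]_n -> 'rV[R]_n,
  [/\ T x = y, forall z, sphere z -> sphere (T z) &
      forall z w, edist (T z) (T w) = edist z w].
Proof.
move=> x1 y1; have [->|] := eqVneq x y; first by exists id.
rewrite -subr_eq0 => u0; exists (reflection (x - y)); split.
- have xx : dot x x = 1 by [].
  have yy : dot y y = 1 by [].
  move: (u0); rewrite -dot_eq0.
  have uu : dot (x - y) (x - y) = 2 * dot x (x - y).
    by rewrite !dotBl !dotBr xx yy (dotC y); ring.
  by rewrite /reflection -uu => h; rewrite divff// scale1r opprB addrC subrK.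
- by move=> z; rewrite /sphere/= dot_reflection.
- by move=> z w; rewrite /edist -reflectionB dot_reflection.
Qed.
End sphere_geometry.

(** * Hausdorff measure *)

Section hausdorff_outer_measure.
Local Open Scope ereal_scope.
Context (R : realType) (n m : nat).
Implicit Types (A B : set 'rV[R]_n) (F : (set 'rV[R]_n)^nat) (delta r : R).

Lemma diam_ge0 A : 0 <= diam A.
Proof. by apply: ereal_sup_ubound; left. Qed.

Lemma edist_le_diam A x y : A x -> A y -> (edist x y)%:E <= diam A.
Proof. by move=> Ax Ay; apply: ereal_sup_ubound; right; exists x => //; exists y. Qed.

Lemma diam_le A (d : \bar R) : 0 <= d ->
  (forall x y, A x -> A y -> (edist x y)%:E <= d) -> diam A <= d.
Proof.
by move=> d0 h; apply: ge_ereal_sup => _ [->//|[x Ax [y Ay <-]]]; exact: h.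
Qed.

Lemma le_diam A B : A `<=` B -> diam A <= diam B.
Proof.
move=> AB; apply: diam_le => [|x y /AB ? /AB ?]; first exact: diam_ge0.
exact: edist_le_diam.
Qed.

Lemma diam0 : diam (@set0 'rV[R]_n) = 0.
Proof. by apply/eqP; rewrite eq_le diam_ge0 andbT; exact: diam_le. Qed.

Lemma lee_expe2r (x y : \bar R) k : 0 <= x -> x <= y -> x ^+ k <= y ^+ k.
Proof.
move=> x0 xy; elim: k => [|k ih]; first by rewrite !expe0.
by rewrite !expeS lee_pmul// expe_ge0.
Qed.

(** The exponent is a successor so that the empty set contributes 0 to a cover. *)
Local Notation "A ^d" := (diam A ^+ m.+1) (at level 1, format "A ^d").

Lemma diamX_ge0 A : 0 <= A^d. Proof. exact/expe_ge0/diam_ge0. Qed.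
Hint Resolve diamX_ge0 : core.

Lemma diamX0 : (@set0 'rV[R]_n)^d = 0.
Proof. by rewrite diam0 expeS mul0e. Qed.

Lemma le_diamX A B : A `<=` B -> A^d <= B^d.
Proof. by move=> AB; apply: lee_expe2r (le_diam AB); exact: diam_ge0. Qed.

Lemma hausdorff_pre_le delta A F : A `<=` \bigcup_k F k ->
  (forall k, diam (F k) <= delta%:E) ->
  hausdorff_pre m.+1 delta A <= \sum_(0 <= k <oo) (F k)^d.
Proof. by move=> AF Fd; apply: ereal_inf_lbound; exists F. Qed.

Lemma hausdorff_pre_cover delta A r :
  hausdorff_pre m.+1 delta A < r%:E ->
  exists F, [/\ A `<=` \bigcup_k F k, forall k, diam (F k) <= delta%:E &
    \sum_(0 <= k <oo) (F k)^d < r%:E].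
Proof. by move=> /ereal_inf_lt[_ [F [AF Fd] <-]]; exists F. Qed.

Lemma le_hausdorff_pre delta A B : A `<=` B ->
  hausdorff_pre m.+1 delta A <= hausdorff_pre m.+1 delta B.
Proof.
move=> AB; apply: ereal_inf_le_tmp => _ [F [BF Fd] <-]; exists F => //.
by split=> //; exact: subset_trans BF.
Qed.

Lemma hausdorff_pre_scale delta delta' A : (delta <= delta')%R ->
  hausdorff_pre m.+1 delta' A <= hausdorff_pre m.+1 delta A.
Proof.
move=> dd; apply: ereal_inf_le_tmp => _ [F [AF Fd] <-]; exists F => //.
by split=> // k; rewrite (le_trans (Fd k))// lee_fin.
Qed.

Lemma hausdorff_pre_ge0 delta A : 0 <= hausdorff_pre m.+1 delta A.
Proof. by apply: le_ereal_inf_tmp => _ [F _ <-]; exact: nneseries_ge0. Qed.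

(** [hausdorff_pre] is the outer extension [mu_ext] of a weight that is [+oo] on sets of diameter
    above [delta]. The sigma-algebra generated by all subsets makes every cover admissible. *)
Lemma hausdorff_pre_sigma_subadditive delta : (0 < delta)%R ->
  sigma_subadditive (@hausdorff_pre R n m.+1 delta).
Proof.
move=> d0.
pose T := g_sigma_algebraType (@setT (set 'rV[R]_n)).
pose w A := if diam A <= delta%:E then A^d else +oo.
have w_ge0 A : 0 <= w A by rewrite /w; case: ifP.
suff -> : @hausdorff_pre R n m.+1 delta = mu_ext (w : set T -> \bar R).
  exact: (@mu_ext_sigma_subadditive _ T R w w_ge0).
apply/funext => A; apply/eqP; rewrite eq_le; apply/andP; split.
  apply: le_ereal_inf_tmp => _ [F [_ AF] <-].
  have [Fd|] := pselect (forall k, diam (F k) <= delta%:E).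
    rewrite (le_trans (hausdorff_pre_le AF Fd))//; apply: lee_nneseries => // k _.
    by rewrite /w Fd.
  move=> /existsNP[k /negP Fk]; rewrite (nneseries_pinfty (k := k)) ?leey//.
  by rewrite /w (negbTE Fk).
apply: le_ereal_inf_tmp => _ [F [AF Fd] <-]; apply: ereal_inf_lbound; exists F.
  by split=> // k; exact: sub_sigma_algebra.
by apply: eq_eseriesr => k _; rewrite /w Fd.
Qed.

Lemma hausdorff_pre_le_hausdorff delta A : (0 < delta)%R ->
  hausdorff_pre m.+1 delta A <= hausdorff m.+1 A.
Proof. by move=> d0; apply: ereal_sup_ubound; exists delta. Qed.

Lemma hausdorff_le A (c : \bar R) :
  (forall delta, (0 < delta)%R -> hausdorff_pre m.+1 delta A <= c) ->
  hausdorff m.+1 A <= c.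
Proof. by move=> h; apply: ge_ereal_sup => _ [d d0 <-]; exact: h. Qed.

Lemma hausdorff_ge0 A : 0 <= hausdorff m.+1 A.
Proof. by apply: le_trans (hausdorff_pre_le_hausdorff _ ltr01); exact: hausdorff_pre_ge0. Qed.

Lemma le_hausdorff : {homo @hausdorff R n m.+1 : A B / A `<=` B >-> A <= B}.
Proof.
move=> A B AB; apply: hausdorff_le => d d0.
exact: le_trans (le_hausdorff_pre _ AB) (hausdorff_pre_le_hausdorff _ d0).
Qed.

Lemma hausdorff0 : hausdorff m.+1 (@set0 'rV[R]_n) = 0.
Proof.
apply/eqP; rewrite eq_le hausdorff_ge0 andbT; apply: hausdorff_le => d d0.
apply: (le_trans (@hausdorff_pre_le d set0 (fun=> set0) _ _)) => //.
  by move=> k; rewrite diam0 lee_fin ltW.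
by rewrite eseries0// => k _ _; exact: diamX0.
Qed.

Lemma hausdorff_sigma_subadditive : sigma_subadditive (@hausdorff R n m.+1).
Proof.
move=> F; apply: hausdorff_le => d d0.
apply: (le_trans (hausdorff_pre_sigma_subadditive d0 F)).
by apply: lee_nneseries => k *; [exact: hausdorff_pre_ge0|exact: hausdorff_pre_le_hausdorff].
Qed.

HB.instance Definition _ := isOuterMeasure.Build R 'rV[R]_n (@hausdorff R n m.+1)
  hausdorff0 hausdorff_ge0 le_hausdorff hausdorff_sigma_subadditive.

(** In a cover of mesh below [r] no set meets both [A] and [B], so the cover splits into a cover of
    each. *)
Lemma hausdorff_separated A B r : (0 < r)%R ->
  (forall x y, A x -> B y -> (r <= edist x y)%R) ->
  hausdorff m.+1 A + hausdorff m.+1 B <= hausdorff m.+1 (A `|` B).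
Proof.
move=> r0 AB.
have sep d : (0 < d)%R -> (d < r)%R ->
    hausdorff_pre m.+1 d A + hausdorff_pre m.+1 d B <= hausdorff m.+1 (A `|` B).
  move=> d0 dr; apply: le_trans (hausdorff_pre_le_hausdorff _ d0).
  apply: le_ereal_inf_tmp => _ [F [ABF Fd] <-].
  have part C : C `<=` \bigcup_k F k ->
      hausdorff_pre m.+1 d C <= \sum_(0 <= k <oo) (F k `&` C)^d.
    move=> CF; apply: hausdorff_pre_le => [x Cx|k].
      by have [k _ Fkx] := CF x Cx; exists k.
    by rewrite (le_trans _ (Fd k))//; apply: le_diam => x [].
  apply: (le_trans (leeD (part A _) (part B _))).
  - by move=> x Ax; apply: ABF; left.
  - by move=> x Bx; apply: ABF; right.
  rewrite -nneseriesD//; apply: lee_nneseries => [k _ _|k _]; first exact: adde_ge0.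
  have [FA0|/set0P[x [Fx Ax]]] := eqVneq (F k `&` A) set0.
    by rewrite FA0 diamX0 add0e; apply: le_diamX => x [].
  rewrite (_ : F k `&` B = set0); first by rewrite diamX0 adde0; apply: le_diamX => y [].
  rewrite -subset0 => y [Fy By].
  have := le_trans (edist_le_diam Fx Fy) (Fd k); rewrite lee_fin => xyd.
  by have := AB x y Ax By; rewrite leNgt (le_lt_trans xyd).
(* The supremum over meshes is taken in one summand at a time, the other one, [b], being fixed. The
   case [b = +oo] is separate because moving [b] across needs it finite. *)
have sup_add (C : set 'rV[R]_n) (b : \bar R) : 0 <= b ->
    (forall d, (0 < d)%R -> hausdorff_pre m.+1 d C + b <= hausdorff m.+1 (A `|` B)) ->
    hausdorff m.+1 C + b <= hausdorff m.+1 (A `|` B).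
  case: b => [b| |//] b0 h.
    by rewrite -leeBrDr//; apply: hausdorff_le => d d0; rewrite leeBrDr// h.
  have Noo (x : \bar R) : 0 <= x -> x != -oo by case: x.
  have := h 1%R ltr01.
  by rewrite !addey// Noo ?hausdorff_ge0 ?hausdorff_pre_ge0.
apply: (sup_add) => [|d d0]; first exact: hausdorff_ge0.
rewrite addeC; apply: sup_add => [|d' d'0]; first exact: hausdorff_pre_ge0.
(* The two meshes are now independent; [e] is below both and below [r], and a smaller mesh only
   increases [hausdorff_pre]. *)
rewrite addeC; pose e : R := Num.min (Num.min d d') (r / 2)%R.
have e0 : (0 < e)%R by rewrite !lt_min d0 d'0 divr_gt0.
have er : (e < r)%R by rewrite gt_min (_ : (r / 2 < r)%R) ?orbT//; lra.
by apply: le_trans (leeD _ _) (sep e e0 er); apply: hausdorff_pre_scale;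
  rewrite !ge_min lexx ?orbT.
Qed.

(** A cover of [B] of mesh [d / L] pulls back along [f] to a cover of [A] of mesh [d], each diameter
    growing at most by the factor [L]. *)
Lemma hausdorff_expansive A B (f : 'rV[R]_n -> 'rV[R]_n) (L : R) : (0 < L)%R ->
  (forall x, A x -> B (f x)) ->
  (forall x y, A x -> A y -> (edist x y <= L * edist (f x) (f y))%R) ->
  hausdorff m.+1 A <= (L ^+ m.+1)%:E * hausdorff m.+1 B.
Proof.
move=> L0 AB fL; apply: hausdorff_le => d d0.
have d'0 : (0 < d / L)%R by rewrite divr_gt0.
apply: (@le_trans _ _ ((L ^+ m.+1)%:E * hausdorff_pre m.+1 (d / L) B)); last first.
  by apply: lee_wpmul2l; [rewrite lee_fin exprn_ge0// ltW|exact: hausdorff_pre_le_hausdorff].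
rewrite -lee_pdivrMl ?exprn_gt0//.
apply: le_ereal_inf_tmp => _ [F [BF Fd] <-]; rewrite lee_pdivrMl ?exprn_gt0//.
pose G k := [set x | A x /\ F k (f x)].
have GF k : diam (G k) <= L%:E * diam (F k).
  apply: diam_le => [|x y [Ax Fx] [Ay Fy]].
    by rewrite mule_ge0 ?diam_ge0// lee_fin ltW.
  apply: (@le_trans _ _ (L * edist (f x) (f y))%:E); first by rewrite lee_fin fL.
  by rewrite EFinM; apply: lee_wpmul2l; [rewrite lee_fin ltW|exact: edist_le_diam].
rewrite -nneseriesZl//.
apply: (le_trans (@hausdorff_pre_le d A G _ _)) => [x Ax|k|].
- by have [k _ Fk] := BF _ (AB x Ax); exists k.
- rewrite (le_trans (GF k))// -lee_pdivlMl// -EFinM mulrC; exact: Fd.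
apply: lee_nneseries => // k _.
have -> : (L ^+ m.+1)%:E * (F k)^d = (L%:E * diam (F k)) ^+ m.+1.
  elim: m.+1 => [|i ih]; first by rewrite !expe0 expr0 mule1.
  by rewrite exprS EFinM !expeS -ih muleACA.
exact: lee_expe2r (diam_ge0 _) (GF k).
Qed.
End hausdorff_outer_measure.

(** * Caratheodory measurability of open sets *)

Section hausdorff_measurable.
Local Open Scope ereal_scope.
Context (R : realType) (n m : nat).
Local Notation T := 'rV[R]_n.
Local Notation H := (@hausdorff R n m.+1).
Implicit Types (A U X : set T).

(** The points at distance at least 1/(k+1) from the complement of [U]. *)
Definition inner_part U (k : nat) : set T :=
  [set x | eball x k.+1%:R^-1 `<=` U].

Lemma inv_succ_gt0 k : (0 < k.+1%:R^-1 :> R)%R. Proof. by rewrite invr_gt0. Qed.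

Lemma inner_part_sub U k : inner_part U k `<=` U.
Proof. by move=> x; apply; exact/eball_center/inv_succ_gt0. Qed.

Lemma inner_partS U : nondecreasing_seq (inner_part U).
Proof.
move=> i j ij; apply/subsetPset => x Ux; apply: subset_trans Ux.
by apply: le_eball; rewrite lef_pV2 ?posrE// ler_nat ltnS.
Qed.

Lemma bigcup_inner_part U : eopen U -> \bigcup_k inner_part U k = U.
Proof.
move=> oU; apply/seteqP; split=> [x [k _]|x Ux]; first exact: inner_part_sub.
have [r r0 rU] := oU x Ux.
have [k kr] : exists k, (k.+1%:R^-1 < r)%R.
  have [k _ /(_ k (leqnn k))] := near_infty_natSinv_lt (PosNum r0).
  by exists k.
by exists k => //; apply: subset_trans rU; exact/le_eball/ltW.
Qed.

Lemma inner_part_separated U k x y : inner_part U k x -> ~ inner_part U k.+1 y ->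
  (k.+1%:R^-1 - k.+2%:R^-1 <= edist x y)%R.
Proof.
move=> Ux; apply: contraPP => /negP; rewrite -ltNge => xy.
apply: contrapT => /contrapT; apply => z; rewrite /eball/= => yz.
apply: Ux; rewrite /eball/= (le_lt_trans (edist_triangle y x z))//.
by rewrite -ltrBrDr (lt_trans xy)// ltrD2l ltrN2.
Qed.

Lemma cvge_exists_le (u : (\bar R)^nat) (l e : R) : (0 < e)%R ->
  u k @[k --> \oo] --> l%:E -> exists N, u N <= (l + e)%:E.
Proof.
move=> e0 /fine_cvgP[[N1 _ uf] /cvgrPdist_le/(_ e e0)[N2 _ h]].
exists (maxn N1 N2); rewrite -[leLHS]fineK; last exact/uf/leq_maxl.
rewrite lee_fin -lerBlDl (le_trans (ler_norm _))// distrC.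
exact/h/leq_maxr.
Qed.

(* The shells D k and D j are separated for j > k + 1, so that the sum of their
   measures is at most 2 H X and its tails tend to 0. *)
Lemma eopen_caratheodory U : eopen U -> H.-caratheodory U.
Proof.
move=> oU; apply: le_caratheodory_measurable => X /=.
have [->|HX] := eqVneq (H X) +oo; first by rewrite leey.
pose V k := X `&` inner_part U k.
pose D k := X `&` (inner_part U k.+1 `\` inner_part U k).
have Vle k : H (V k) + H (X `&` ~` U) <= H X.
  have h := @hausdorff_separated R n m (V k) (X `&` ~` U) _ (inv_succ_gt0 k).
  apply: (le_trans (h _)); last apply: le_hausdorff.
    move=> x y [_ Ux] [_ Uy]; rewrite leNgt; apply/negP => xy; exact/Uy/Ux.
  by move=> x [[]|[]].
have VD k : H (V k) + H (D k.+1) <= H (V k.+2).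
  have r0 : (0 < k.+1%:R^-1 - k.+2%:R^-1 :> R)%R.
    by rewrite subr_gt0 ltf_pV2 ?posrE// ltr_nat.
  apply: (le_trans (@hausdorff_separated R n m (V k) (D k.+1) _ r0 _)); last first.
    apply: le_hausdorff => x [[Xx Ux]|[Xx [Ux _]]]; split=> //.
    by have /subsetPset := @inner_partS U k k.+2 (leq_trans (leqnSn _) (leqnSn _)); apply.
  by move=> x y [_ Ux] [_ [_ Uy]]; exact: inner_part_separated Ux Uy.
(* Each step trades [H (V N) + H (D N.+1)] for [H (V N.+2)] by [VD]; the two terms on the right
   collect shells of alternate parity. *)
have sumD N : \sum_(0 <= k < N) H (D k.+1) + (H (V 0%N) + H (V 1%N)) <=
    H (V N) + H (V N.+1).
  elim: N => [|N ih]; first by rewrite big_geq// add0e.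
  rewrite big_nat_recr//= addeAC addeC.
  apply: le_trans (leeD2l _ ih) _; rewrite addeA addeC; apply: leeD2l.
  by rewrite addeC; exact: VD.
have finsum : \sum_(0 <= k <oo) H (D k.+1) < +oo.
  apply: (@le_lt_trans _ _ (H X + H X)); last by rewrite lte_add_pinfty ?ltey.
  apply: lime_le; first by apply: is_cvg_nneseries => k _ _; exact: hausdorff_ge0.
  apply: nearW => N; apply: (@le_trans _ _ (H (V N) + H (V N.+1))).
    by apply: le_trans (sumD N); rewrite leeDl// adde_ge0// hausdorff_ge0.
  by apply: leeD; apply: le_hausdorff => x [].
apply/lee_addgt0Pr => e e0.
have /(@cvge_exists_le _ 0%R _ e0)[N] :=
  nneseries_tail_cvg finsum (fun k _ => hausdorff_ge0 m (D k.+1)).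
rewrite add0r => tailN.
(* A point of [U] outside [inner_part U N.+1] lies in the shell [D j] where it first enters. The
   tail runs over [D k.+1], whence the index [j.-1]. *)
have XU : X `&` U `<=` V N.+1 `|` \bigcup_(k in ~` `I_N) D k.+1.
  rewrite -{1}(bigcup_inner_part oU) => x [Xx Ux].
  have [xN|xN] := pselect (inner_part U N.+1 x); first by left; split.
  right; case: Ux => j _; elim: j => [|j ih] xj.
    by case: xN; have /subsetPset := @inner_partS U 0%N N.+1 isT; apply.
  have [/ih//|xj'] := pselect (inner_part U j x).
  have Nj : (N < j)%N.
    rewrite ltnNge; apply/negP => jN; apply: xN.
    by have /subsetPset := @inner_partS U j.+1 N.+1 jN; apply.
  exists j.-1; first by apply/negP; rewrite -leqNgt -ltnS (ltn_predK Nj).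
  by rewrite (ltn_predK Nj).
apply: (@le_trans _ _ (H (V N.+1) + \sum_(N <= k <oo) H (D k.+1) + H (X `&` ~` U))).
  apply: leeD2r; apply: le_trans (le_hausdorff _ XU) _.
  apply: le_trans (outer_measureU2 _ _ _) _; apply: leeD2l.
  exact: (outer_measure_sigma_subadditive_tail _ N (fun k => D k.+1)).
by rewrite addeAC; apply: leeD.
Qed.
End hausdorff_measurable.

(** Continuity from above of the measure induced by [mu] on its Caratheodory sets, read off at one
    index. *)
Lemma caratheodory_bigcap_le (R : realType) (T : pointedType)
    (mu : {outer_measure set T -> \bar R}) (F : (set T)^nat) (l e : R) :
  (mu (F 0%N) < +oo)%E -> (forall k, mu.-caratheodory (F k)) ->
  nonincreasing_seq F -> (mu (\bigcap_k F k) <= l%:E)%E -> 0 < e ->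
  exists N, (mu (F N) <= (l + e)%:E)%E.
Proof.
move=> F0 mF Fdec Fl e0.
have mcap : mu.-cara.-measurable (\bigcap_k F k).
  by apply: (@bigcapT_measurable _ (caratheodory_type mu)) => k; exact: mF.
have Fcvg := @nonincreasing_cvg_mu _ (caratheodory_type mu) R mu F F0 mF mcap Fdec.
have capfin : mu (\bigcap_k F k) \is a fin_num.
  by rewrite ge0_fin_numE ?outer_measure_ge0// (le_lt_trans Fl)// ltry.
move: Fcvg; rewrite -[X in _ --> X]fineK// => /(cvge_exists_le e0)[N FN].
exists N; apply: le_trans FN _.
by rewrite lee_fin lerD2r -lee_fin fineK.
Qed.

(** * Outer regularity of Hausdorff measure *)

Section outer_regularity.
Local Open Scope ereal_scope.
Context (R : realType) (n m : nat).
Local Notation T := 'rV[R]_n.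
Local Notation H := (@hausdorff R n m.+1).
Implicit Types (A S G : set T) (F : (set T)^nat) (d e l : R).

Definition thicken A e : set T := [set x | exists2 y, A y & (edist y x < e)%R].

Lemma subset_thicken A e : (0 < e)%R -> A `<=` thicken A e.
Proof. by move=> e0 x Ax; exists x => //; rewrite edistxx. Qed.

Lemma eopen_thicken A e : eopen (thicken A e).
Proof.
move=> x [y Ay /eopen_eball[r r0 h]]; exists r => // z /h yz.
by exists y.
Qed.

Lemma diam_thicken A d e : (0 <= d)%R -> (0 < e)%R ->
  diam A <= d%:E -> diam (thicken A e) <= (d + 2 * e)%:E.
Proof.
move=> d0 e0 Ad; apply: diam_le => [|x y [x' Ax xx'] [y' Ay yy']].
  by rewrite lee_fin; lra.
have := le_trans (edist_le_diam Ax Ay) Ad; rewrite !lee_fin => xy.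
have := edist_triangle x' x y; have := edist_triangle y' x' y.
by rewrite (edistC x x'); lra.
Qed.

Lemma exists_eopen_diam (k : nat) A d d' e : (d < d')%R -> (0 < e)%R -> diam A <= d%:E ->
  exists G, [/\ eopen G, A `<=` G, diam G <= d'%:E &
    diam G ^+ k <= diam A ^+ k + e%:E].
Proof.
move=> dd' e0 Ad.
have Afin : diam A \is a fin_num by rewrite ge0_fin_numE ?diam_ge0// (le_lt_trans Ad) ?ltry.
pose a := fine (diam A).
have AE : diam A = a%:E by rewrite fineK.
have a0 : (0 <= a)%R by rewrite -lee_fin -AE diam_ge0.
have ad : (a <= d)%R by rewrite -lee_fin -AE.
have /cvgrPdist_le/(_ e e0)/nbhs_ballP[r /= r0 ra] := @exprn_continuous R k a.
(* Thickening by [s] adds at most [2 * s] to the diameter: this is below [r], for the continuity of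
   the power, and at most [d' - d], for the mesh. *)
pose s : R := Num.min (r / 4)%R ((d' - d) / 2)%R.
have s0 : (0 < s)%R by rewrite lt_min; apply/andP; split; lra.
have sr : (s <= r / 4)%R by rewrite ge_min lexx.
have sd : (s <= (d' - d) / 2)%R by rewrite ge_min lexx orbT.
have AG : diam (thicken A s) <= (a + 2 * s)%:E by apply: diam_thicken; rewrite ?AE.
exists (thicken A s); split.
- exact: eopen_thicken.
- exact: subset_thicken.
- by apply: le_trans AG _; rewrite lee_fin; lra.
have := lee_expe2r k (diam_ge0 _) AG.
rewrite AE -!EFin_expe -EFinD => /le_trans; apply; rewrite lee_fin.
have /ra : ball a r (a + 2 * s)%R.
  by rewrite /ball/= opprD addrA subrr sub0r normrN gtr0_norm; lra.
by rewrite distrC => /(le_trans (ler_norm _)); rewrite lerBlDl.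
Qed.

Lemma exists_eopen_pre A d l : (0 < d)%R -> H A <= l%:E ->
  exists G, [/\ eopen G, A `<=` G &
    hausdorff_pre m.+1 (2 * d)%R G <= (l + 2 * d)%:E].
Proof.
move=> d0 Al.
have : hausdorff_pre m.+1 d A < (l + d)%:E.
  apply: le_lt_trans (hausdorff_pre_le_hausdorff _ _ d0) (le_lt_trans Al _).
  by rewrite lte_fin ltrDl.
move=> /hausdorff_pre_cover[F [AF Fd sumF]].
(* The errors [d / 2 ^ k.+1] sum to [d]; the other [d] in the bound is the slack in the choice of
   [F]. *)
have /choice[G GP] : forall k, exists G, [/\ eopen G, F k `<=` G,
    diam G <= (2 * d)%:E &
    diam G ^+ m.+1 <= diam (F k) ^+ m.+1 + (d / (2 ^ k.+1)%:R)%:E].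
  by move=> k; apply: exists_eopen_diam (Fd k); rewrite ?divr_gt0//; lra.
exists (\bigcup_k G k); split.
- by apply: eopen_bigcup => k; have [] := GP k.
- by move=> x /AF[k _ Fx]; exists k => //; have [_ + _ _] := GP k; apply.
apply: le_trans (@hausdorff_pre_le _ _ m _ _ G _ _) _ => //.
  by move=> k; have [] := GP k.
apply: (@le_trans _ _
    (\sum_(0 <= k <oo) (diam (F k) ^+ m.+1 + (d / (2 ^ k.+1)%:R)%:E))).
  by apply: lee_nneseries => [k _ _|k _]; [exact: diamX_ge0|have [] := GP k].
apply: le_trans (epsilon_trick _ _ _) _; [|exact: ltW|].
  by move=> k; exact: diamX_ge0.
apply: le_trans (leeD2r _ (ltW sumF)) _.
by rewrite -EFinD lee_fin; lra.
Qed.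

(** Open sets that cover [A] almost optimally at meshes tending to 0 meet in a set of measure at
    most [H A]. Continuity from above inside [S] then makes a finite intersection sufficient. *)
Lemma hausdorff_outer_regular A S e : H.-caratheodory S -> H S < +oo ->
  A `<=` S -> (0 < e)%R ->
  exists2 G, eopen G /\ A `<=` G & H (G `&` S) <= H A + e%:E.
Proof.
move=> mS Sfin AS e0.
have Afin : H A \is a fin_num.
  by rewrite ge0_fin_numE ?hausdorff_ge0// (le_lt_trans (le_hausdorff _ AS)).
have AE : H A = (fine (H A))%:E by rewrite fineK.
have /choice[G GP] : forall j, exists G, [/\ eopen G, A `<=` G &
    hausdorff_pre m.+1 (2 * j.+1%:R^-1)%R G <= (fine (H A) + 2 * j.+1%:R^-1)%:E].
  move=> j; apply: exists_eopen_pre; first exact: inv_succ_gt0.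
  by rewrite -AE.
pose I := fix I j := if j is i.+1 then I i `&` G i.+1 else G 0%N.
have Io j : eopen (I j).
  elim: j => [|j ih] /=; first by have [] := GP 0%N.
  by apply: eopenI => //; have [] := GP j.+1.
have AI j : A `<=` I j.
  elim: j => [|j ih] /=; first by have [] := GP 0%N.
  by move=> x Ax; split; [exact: ih|have [_ + _] := GP j.+1; apply].
have IG j : I j `<=` G j by case: j => [//|j] x [].
have [||||N IN] := @caratheodory_bigcap_le R T H (fun j => I j `&` S) (fine (H A)) e _ _ _ _ e0.
- by apply: le_lt_trans Sfin; apply: le_hausdorff => x [].
- by move=> k; apply: caratheodory_measurable_setI => //; exact: eopen_caratheodory.
- apply/nonincreasing_seqP => j; apply/subsetPset.
  by move=> x [[Ix _] Sx]; split.
- rewrite -AE; apply: hausdorff_le => d d0.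
  apply/lee_addgt0Pr => f f0.
  (* The mesh of [G j] must be at most [d], for the comparison of pre-measures, and its error at
     most [f]. *)
  have [j jdf] : exists j, (2 * j.+1%:R^-1 <= Num.min d f :> R)%R.
    have df0 : (0 < Num.min d f / 2)%R by rewrite divr_gt0// lt_min d0.
    have [j _ /(_ j (leqnn j))/= /ltW jdf] := near_infty_natSinv_lt (PosNum df0).
    by exists j; rewrite mulrC -ler_pdivlMr.
  have [jd jf] : (2 * j.+1%:R^-1 <= d)%R /\ (2 * j.+1%:R^-1 <= f)%R.
    by move: jdf; rewrite le_min => /andP.
  apply: le_trans (hausdorff_pre_scale _ _ jd) _.
  apply: (@le_trans _ _ (hausdorff_pre m.+1 (2 * j.+1%:R^-1)%R (G j))).
    by apply: le_hausdorff_pre => x /(_ j Logic.I)[/IG].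
  have [_ _ /le_trans] := GP j; apply.
  by rewrite AE -EFinD lee_fin lerD2l.
by exists (I N) => //; rewrite AE -EFinD.
Qed.
End outer_regularity.

(** * Caps of the sphere and density *)

Section caps.
Local Open Scope ereal_scope.
Context (R : realType) (n m : nat).
Local Notation T := 'rV[R]_n.
Local Notation H := (@hausdorff R n m.+1).
Implicit Types (x y z : T) (r : R).

Definition cap x r : set T := @sphere R n `&` eball x r.

Lemma hausdorff_cap_sphere x r : H (cap x r) <= H (@sphere R n).
Proof. by apply: le_hausdorff => z []. Qed.

Lemma hausdorff_cap x y r : sphere x -> sphere y -> H (cap x r) = H (cap y r).
Proof.
have le u v : sphere u -> sphere v -> H (cap u r) <= H (cap v r).
  move=> u1 v1; have [f [fu fS fd]] := sphere_transitive u1 v1.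
  have := @hausdorff_expansive R n m (cap u r) (cap v r) f 1 ltr01.
  rewrite expr1n mul1e; apply=> [z [z1 uz]|z w _ _]; last by rewrite mul1r fd.
  by split; [exact: fS|rewrite /eball/= -fu fd].
by move=> x1 y1; apply/eqP; rewrite eq_le !le.
Qed.

Lemma outer_measure_bigsetU (U : Type) (mu : {outer_measure set U -> \bar R})
    (I : Type) (s : seq I) (F : I -> set U) (c : \bar R) :
  (forall i, mu (F i) <= c) ->
  mu (\big[setU/set0]_(i <- s) F i) <= (size s)%:R%:E * c.
Proof.
move=> Fc; elim: s => [|i s ih]; first by rewrite big_nil mul0e outer_measure0.
rewrite big_cons; apply: le_trans (outer_measureU2 _ _ _) _.
have c0 : 0 <= c by apply: le_trans (Fc i); exact: outer_measure_ge0.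
by rewrite /= -natr1 EFinD ge0_muleDl ?lee_fin// mul1e addeC; exact: leeD.
Qed.

(** The Euclidean norm is at most sqrt(n) times the sup norm, and sqrt(n) < M. *)
Lemma grid_edist x y r (M : nat) : (0 < r)%R -> (n < M ^ 2)%N ->
  (forall i, (`|x 0%R i - y 0%R i| <= r / M%:R)%R) -> (edist x y < r)%R.
Proof.
move=> r0 nM xy; rewrite edist_lt 1?ltW//.
have M0 : (0 < M%:R :> R)%R by rewrite ltr0n; case: M nM {xy}.
apply: (@le_lt_trans _ _ (\sum_(i < n) (r / M%:R) ^+ 2)%R).
  apply: ler_sum => i _; rewrite !mxE -expr2 -real_normK ?num_real//.
  by rewrite ler_pXn2r// ?nnegrE// divr_ge0// ltW.
rewrite sumr_const card_ord -(mulr_natr _ n) exprMn -mulrA gtr_pMr ?exprn_gt0//.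
by rewrite exprVn mulrC ltr_pdivrMr ?exprn_gt0// mul1r -natrX ltr_nat.
Qed.

(** A grid of mesh [r / M] cuts the large cap into a number of pieces that depends only on [k] and
    [n]. A piece containing [p] lies in [cap p r], which has the measure of [cap y r]. *)
Lemma hausdorff_cap_scale (k : nat) : exists N : nat, forall x y r,
  sphere x -> sphere y -> (0 < r)%R ->
  H (cap x (k%:R * r)%R) <= N%:R%:E * H (cap y r).
Proof.
pose M := n.+1; pose I := {ffun 'I_n -> 'I_(k * M + k * M).+1}.
exists (size (index_enum I)) => x y r x1 y1 r0.
have M0 : (0 < M%:R :> R)%R by rewrite ltr0n.
(* Coordinates relative to [x] in units of [r / M], shifted by [k * M] to make them nonnegative
   before truncation. *)
pose g z (i : 'I_n) : R := ((z 0%R i - x 0%R i) / r * M%:R + (k * M)%:R)%R.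
pose C (f : I) := cap x (k%:R * r)%R `&` [set z | forall i, f i = Num.truncn (g z i) :> nat].
have gP z i : cap x (k%:R * r)%R z -> (0 <= g z i < (k * M + k * M).+1%:R)%R.
  move=> [_]; rewrite /eball/= => xz.
  have := le_lt_trans (coord_le_edist x z i) xz.
  rewrite -ltr_pdivrMr// -[X in (_ / X)%R](gtr0_norm r0) -normf_div ltr_norml.
  move=> /andP[h1 h2]; rewrite /g -[(z 0%R i - _)%R]opprB mulNr mulNr.
  move: (_ / r)%R h1 h2 => q h1 h2.
  have h1' : (- (k * M)%:R <= q * M%:R)%R by rewrite natrM -mulNr ler_pM2r// ltW.
  have h2' : (q * M%:R <= (k * M)%:R)%R by rewrite natrM ler_pM2r// ltW.
  rewrite -natr1 natrD; apply/andP; split; lra.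
have capC : cap x (k%:R * r)%R `<=` \big[setU/set0]_(f : I) C f.
  move=> z xz; pose f : I := [ffun i => inord (Num.truncn (g z i))].
  rewrite (bigD1 f)//=; left; split=> // i; rewrite ffunE inordK//.
  by have /andP[g0 gk] := gP z i xz; rewrite -(@ltr_nat R) (le_lt_trans _ gk)// truncn_le.
apply: le_trans (le_hausdorff m capC) _; apply: outer_measure_bigsetU => f.
have [->|/set0P[p [xp pf]]] := eqVneq (C f) set0.
  by rewrite outer_measure0 hausdorff_ge0.
rewrite -(hausdorff_cap r xp.1 y1); apply: le_hausdorff => z [xz zf].
split; first exact: xz.1.
apply: (@grid_edist _ _ _ M) => // [|i]; first by rewrite expnS expn1 leq_pmulr.
have gzp : (`|g p i - g z i| <= 1)%R.
  have /andP[p0 _] := gP p i xp; have /andP[z0 _] := gP z i xz.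
  have := truncn_itv p0; have := truncn_itv z0.
  rewrite -(pf i) -(zf i) -natr1 => /andP[? ?] /andP[? ?].
  by rewrite ler_norml; apply/andP; split; lra.
rewrite ler_pdivlMr// -(@ler_pM2r _ r^-1)%R ?invr_gt0// divff ?gt_eqF//.
apply: le_trans gzp.
have -> : (g p i - g z i = (p 0%R i - z 0%R i) * (M%:R / r))%R by rewrite /g; ring.
by rewrite normrM (gtr0_norm (divr_gt0 M0 r0)) mulrA.
Qed.
End caps.

(** * Packings and density at a single radius *)

Section density.
Local Open Scope ereal_scope.
Context (R : realType) (n m : nat).
Local Notation T := 'rV[R]_n.
Local Notation H := (@hausdorff R n m.+1).
Local Notation S := (@sphere R n).
Implicit Types (A I W : set T) (x y z : T) (r c e : R).

Lemma caratheodory_sphere : H.-caratheodory S.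
Proof.
rewrite -[S]setCK; apply: caratheodory_measurable_setC.
exact/eopen_caratheodory/eopen_setC_sphere.
Qed.

Lemma caratheodory_inner_part U k : H.-caratheodory (@inner_part R n U k).
Proof.
have -> : inner_part U k = ~` thicken (~` U) k.+1%:R^-1.
  apply/seteqP; split=> [x Ux [y Uy]|x nUx y].
    by rewrite edistC => /Ux.
  rewrite /eball/= => xy; apply: contrapT => Uy; apply: nUx.
  by exists y => //; rewrite edistC.
exact/caratheodory_measurable_setC/eopen_caratheodory/eopen_thicken.
Qed.

Lemma hausdorff_cap_gt0 x r :
  0 < H S -> sphere x -> (0 < r)%R -> 0 < H (cap x r).
Proof.
move=> S0 x1 r0.
rewrite lt_def hausdorff_ge0 andbT; apply/eqP => cap0.
(* [k%:R * r] exceeds 2, the largest distance on the sphere, so the cap of this radius is the whole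
   sphere. *)
pose k := (Num.truncn (2 / r)).+1.
have kr : (2 < k%:R * r)%R by rewrite -ltr_pdivrMr// truncnS_gt.
have [N] := @hausdorff_cap_scale R n m k.
move=> /(_ x x r x1 x1 r0); rewrite cap0 mule0 leNgt => /negP; apply.
apply: lt_le_trans S0 _; apply: le_hausdorff => z z1; split=> //.
rewrite /eball/=; apply: le_lt_trans kr.
have := dot_sphere_le1 x1 (sphereN z1); rewrite dotNr => xz.
by rewrite -(@ler_pXn2r _ 2%N)// ?nnegrE ?edist_ge0// edist_sphere//; lra.
Qed.

(** Balls of radius [r] about [2 * r]-separated centres are disjoint and, being open, Caratheodory
    measurable: they split off one by one from an arbitrary [W]. *)
Lemma hausdorff_packing W r (v : \bar R) (p : nat -> T) N : 0 <= v ->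
  (forall i, (i < N)%N -> v <= H (eball (p i) r `&` W)) ->
  (forall i j, (i < j < N)%N -> (2 * r <= edist (p i) (p j))%R) ->
  N%:R%:E * v <= H W.
Proof.
move=> v0 pW psep.
pose B k := [set y | exists2 i, (i < k)%N & eball (p i) r y].
have Bo k : eopen (B k).
  move=> x [i ik /eopen_eball[s s0 h]]; exists s => // z /h zi.
  by exists i.
suff h k : (k <= N)%N -> k%:R%:E * v <= H (W `&` B k).
  by apply: le_trans (h N _) (le_hausdorff _ _) => // x [].
elim: k => [_|k ih kN]; first by rewrite mul0e hausdorff_ge0.
rewrite (eopen_caratheodory m (Bo k) (W `&` B k.+1)).
rewrite -natr1 EFinD ge0_muleDl ?lee_fin// mul1e; apply: leeD.
  apply: le_trans (ih (ltnW kN)) _; apply: le_hausdorff => y [Wy [i ik yi]].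
  by split; [split=> //; exists i => //; exact: ltnW|exists i].
apply: le_trans (pW k kN) _; apply: le_hausdorff => y [yk Wy]; split.
  by split=> //; exists k.
move=> [i ik]; move: yk; rewrite /eball/= => yk yi.
have := psep i k; rewrite ik kN => /(_ isT).
by have := edist_triangle y (p i) (p k); rewrite (edistC y); lra.
Qed.

(** The mass bound limits packings to [w / v] balls, so a largest one exists; a point of [D] outside
    all doubled balls could be added as a new centre. *)
Lemma exists_packing (D W : set T) r (v w : R) : (0 < v)%R ->
  (forall x, D x -> v%:E <= H (eball x r `&` W)) -> H W <= w%:E ->
  exists N (p : nat -> T), [/\ (N%:R * v <= w)%R,
    forall i, (i < N)%N -> D (p i) &
    forall x, D x -> exists2 i, (i < N)%N & eball (p i) (2 * r) x].
Proof.
move=> v0 DW Ww.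
pose P N := exists p : nat -> T, (forall i, (i < N)%N -> D (p i)) /\
  (forall i j, (i < j < N)%N -> (2 * r <= edist (p i) (p j))%R).
have P0 : P 0%N.
  by exists (fun=> 0%R); split=> [//|i j]; rewrite ltn0 andbF.
have PN N : P N -> (N%:R * v <= w)%R.
  move=> [p [Dp psep]]; rewrite -lee_fin EFinM (le_trans _ Ww)//.
  apply: (@hausdorff_packing _ r _ p) => // [|i /Dp]; first by rewrite lee_fin ltW.
  exact: DW.
have exP : exists N, `[< P N >] by exists 0%N; exact/asboolP.
have bndP N : `[< P N >] -> (N <= Num.truncn (w / v))%N.
  move=> /asboolP/PN; rewrite -ler_pdivlMr// => Nwv.
  by rewrite truncn_ge_nat ?(le_trans _ Nwv).
have [N /asboolP[p [Dp psep]] Nmax] := ex_maxnP exP bndP.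
exists N, p; split=> //; first by apply: PN; exists p.
move=> x Dx; apply: contrapT => xN.
have /asboolP/Nmax : P N.+1; last by rewrite ltnn.
exists (fun i => if i == N then x else p i); split=> [i|i j].
  by rewrite ltnS leq_eqVlt; case: eqP => //= _; exact: Dp.
move=> /andP[ij]; rewrite ltnS leq_eqVlt => /predU1P[jN|jN]; last first.
  by rewrite !ltn_eqF ?(ltn_trans ij)//; apply: psep; rewrite ij.
move: ij; rewrite jN eqxx => iN; rewrite ltn_eqF// leNgt; apply/negP => xi.
by apply: xN; exists i.
Qed.

Lemma sphere_density I c e r0 : 0 < H S -> H S < +oo ->
  H.-caratheodory I -> I `<=` S -> (0 < c)%R -> (0 < e)%R -> (0 < r0)%R ->
  exists r J, [/\ (0 < r <= r0)%R, H.-caratheodory J, J `<=` I,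
    H I <= H J + e%:E &
    forall x, J x -> H (eball x r `&` (S `\` I)) <= c%:E * H (cap x r)].
Proof.
move=> S0 Soo mI IS c0 e0 r00.
have [->|/set0P[x0 Ix0]] := eqVneq I set0.
  exists r0, set0; split=> //; first by rewrite r00 lexx.
  - exact: caratheodory_measurable_set0.
  - by rewrite hausdorff0 add0e lee_fin ltW.
have [D capD] := hausdorff_cap_scale R n m 2.
(* At most [eta / (c * gamma)] doubled caps, each of measure at most [D%:R * gamma], will have total
   measure at most [e / 2]. The successor of [D] keeps the denominator positive. *)
pose eta : R := (c * (e / 2) / D.+1%:R)%R.
have eta0 : (0 < eta)%R by rewrite divr_gt0// mulr_gt0// divr_gt0.
have [G [oG IG] GI] := hausdorff_outer_regular caratheodory_sphere Soo IS eta0.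
pose W := (G `&` S) `\` I.
have fin A : A `<=` S -> H A \is a fin_num.
  by move=> AS; rewrite ge0_fin_numE ?hausdorff_ge0// (le_lt_trans (le_hausdorff _ AS)).
have HW : H W <= eta%:E.
  move: GI; rewrite (mI (G `&` S)) (_ : G `&` S `&` I = I) ?leeD2lE ?fin//.
  by apply/seteqP; split=> [x []//|x Ix]; split=> //; split; [exact: IG|exact: IS].
(* The points of [I] close to the complement of [G]; these sets decrease to the empty set. *)
pose F k := I `\` inner_part G k.
have e20 : (0 < e / 2)%R by rewrite divr_gt0.
have [||||N] := @caratheodory_bigcap_le R T H F 0%R (e / 2)%R _ _ _ _ e20.
- by apply: le_lt_trans Soo; apply: le_hausdorff => x [/IS].
- by move=> k; apply: caratheodory_measurable_setD => //; exact: caratheodory_inner_part.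
- move=> i j ij; apply/subsetPset; apply: setDS.
  exact/subsetPset/inner_partS.
- rewrite bigcupDr; last by exists 0%N.
  have IG0 : I `\` G = set0 by rewrite setD_eq0.
  by rewrite bigcup_inner_part// IG0 outer_measure0.
rewrite add0r => FN.
pose r : R := Num.min r0 N.+1%:R^-1%R.
have rpos : (0 < r)%R by rewrite lt_min r00 inv_succ_gt0.
have rN : (r <= N.+1%:R^-1)%R by rewrite ge_min lexx orbT.
have x01 := IS _ Ix0.
pose gamma := fine (H (cap x0 r)).
have gammaE x : sphere x -> H (cap x r) = gamma%:E.
  move=> x1; rewrite fineK ?fin//; last by move=> z [].
  exact: hausdorff_cap.
have gamma0 : (0 < gamma)%R by rewrite -lte_fin -(gammaE x0)// hausdorff_cap_gt0.
(* For [x] in [inner_part G N] the ball of radius [r] stays in [G], so the part of the cap outside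
   [I] lies in the small set [W]. *)
pose Bad := [set x | I x /\ inner_part G N x /\
  ~ (H (eball x r `&` (S `\` I)) <= c%:E * H (cap x r))].
have BadW x : Bad x -> (c * gamma)%:E <= H (eball x r `&` W).
  move=> [Ix [Gx /negP]]; rewrite -ltNge gammaE; last exact: IS.
  rewrite -EFinM => /ltW/le_trans; apply; apply: le_hausdorff => y [xy [Sy Iy]].
  by split=> //; split=> //; split=> //; apply: Gx; apply: le_eball xy.
have [M [p [Meta Bp Bcov]]] := exists_packing (mulr_gt0 c0 gamma0) BadW HW.
pose J := (I `&` inner_part G N) `\` [set x | exists2 i, (i < M)%N & eball (p i) (2 * r)%R x].
exists r, J; split.
- by rewrite rpos ge_min lexx.
- apply: caratheodory_measurable_setD.
    by apply: caratheodory_measurable_setI => //; exact: caratheodory_inner_part.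
  apply: eopen_caratheodory => x [i iM /eopen_eball[s s0 h]]; exists s => // y /h yi.
  by exists i.
- by move=> x [[]].
(* The default [set0] makes the bound on [H (C i)] hold at every index, as [outer_measure_bigsetU]
   requires. *)
- pose C i := if (i < M)%N then cap (p i) (2 * r)%R else set0.
  pose CM := \big[setU/set0]_(i <- iota 0 M) C i.
  have HC : H CM <= (e / 2)%:E.
    apply: (@le_trans _ _ (M%:R%:E * (D%:R * gamma)%:E)).
      rewrite -[in leRHS](size_iota 0 M); apply: outer_measure_bigsetU => i.
      rewrite /C; case: ifPn => [iM|_]; last first.
        by rewrite outer_measure0 lee_fin mulr_ge0// ltW.
      have pS : sphere (p i) by apply: IS; exact: (Bp i iM).1.
      by rewrite EFinM -(gammaE _ pS); apply: capD.
    rewrite -EFinM lee_fin mulrCA.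
    have Mg : (M%:R * gamma <= e / 2 / D.+1%:R)%R.
      by rewrite -(ler_pM2l c0) mulrCA [leRHS]mulrA.
    rewrite (le_trans (ler_wpM2l (ler0n _ _) Mg))//.
    rewrite mulrCA ger_pMr// ler_pdivrMr// mul1r ler_nat//.
  have ICJ : I `<=` F N `|` (CM `|` J).
    move=> x Ix; have [xN|xN] := pselect (inner_part G N x); last by left.
    right; have [xB|xB] := pselect (exists2 i, (i < M)%N & eball (p i) (2 * r)%R x).
      left; case: xB => i iM xi; rewrite /CM (bigD1_seq i)/= ?iota_uniq ?mem_iota//.
      by left; rewrite /C iM; split=> //; exact: IS.
    by right.
  apply: le_trans (le_hausdorff _ ICJ) _.
  apply: le_trans (outer_measureU2 _ _ _) _.
  apply: le_trans (leeD FN (outer_measureU2 _ _ _)) _ => /=.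
  apply: le_trans (leeD2l _ (leeD2r _ HC)) _.
  rewrite addeA -EFinD addeC -splitr//.
move=> x [[Ix xN] xB]; apply: contrapT => xc.
by apply: xB; apply: Bcov.
Qed.
End density.

(** * Avoiding sets *)

Section avoiding.
Local Open Scope ereal_scope.
Context (R : realType) (m : nat).
Local Notation T := 'rV[R]_m.+2.
Local Notation H := (@hausdorff R m.+2 m.+1).
Local Notation S := (@sphere R m.+2).
Implicit Types (X : set R) (I J : set T) (r c e : R).

(* If <x, y> is a limit of values t in X, move x onto nearly y by a map F with
   <z, F z> = t: as the complement of I is thin at both x and y, some z near x
   has both z and F z in I. *)
Lemma exists_avoiding_density : 0 < H S -> H S < +oo ->
  exists2 c, (0 < c)%R & forall X I r x y, X `<=` `[(-1)%R, 1%R]%classic ->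
    avoiding X I -> (0 < r <= 1 / 30)%R -> S x -> S y ->
    H (eball x r `&` (S `\` I)) <= c%:E * H (cap x r) ->
    H (eball y r `&` (S `\` I)) <= c%:E * H (cap y r) ->
    ~ closure X (dot x y).
Proof.
move=> S0 Soo; have [D capD] := hausdorff_cap_scale R m.+2 m 4.
(* [L] adds the shares of the complement near [x] and near [y], the latter magnified by [2 ^+ m.+1]
   under the inverse of [F]. With this [c] they fill at most D/(D+1) of the cap of radius
   [r / 4]. *)
pose L : R := (1 + 2 ^+ m.+1)%R.
have L0 : (0 < L)%R by rewrite addr_gt0// exprn_gt0.
pose c : R := (D.+1%:R * L)^-1%R.
have c0 : (0 < c)%R by rewrite invr_gt0 mulr_gt0.
exists c => //.
move=> X I r x y X1 XI /andP[r0 r30] x1 y1 xI yI.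
(* The squared distance from [F x] to [y] is at most [4 * d], that is, [(r / 2) ^+ 2]. *)
pose d : R := ((r / 2) ^+ 2 / 4)%R.
have d0 : (0 < d)%R by rewrite divr_gt0// exprn_gt0// divr_gt0.
move=> /(_ (ball (dot x y) d) (nbhsx_ballx _ _ d0))[t [Xt]].
rewrite /ball/= distrC => td.
have t1 : (t ^+ 2 <= 1)%R.
  by have := X1 t Xt; rewrite /= in_itv/= => /andP[? ?]; nra.
have [F [Fxy F1 Fd]] := sphere_rotation_near (isT : (2 <= m.+2)%N) x1 y1 t1.
have {Fxy} Fxy : (edist (F x) y < r / 2)%R.
  have r20 : (0 <= r / 2)%R by lra.
  rewrite -(@ltr_pXn2r _ 2%N)// ?nnegrE ?edist_ge0// (le_lt_trans Fxy)//.
  by move: td; rewrite /d; lra.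
(* [F] at most doubles distances, so the cap of radius [s] lands within [r / 2] of [F x], hence
   within [r] of [y]. *)
pose s : R := (r / 4)%R.
have s0 : (0 < s)%R by rewrite /s; lra.
have near z : cap x s z -> S z /\ (edist x z <= 1 / 30)%R.
  by move=> [z1]; rewrite /eball/= /s; split=> //; lra.
pose A := [set z | cap x s z /\ ~ I (F z)].
have HA : H A <= (2 ^+ m.+1)%:E * H (eball y r `&` (S `\` I)).
  apply: (@hausdorff_expansive R m.+2 m _ _ F) => // [z [xz nI]|z w [xz _] [xw _]].
    have [z1 xz30] := near z xz; have [Fz1 _] := F1 z z1 xz30.
    split; last by split.
    have := (Fd x z x1 z1 _ xz30).2; rewrite edistxx => /(_ _)/=.
    have := edist_triangle (F x) y (F z); rewrite /eball/= (edistC y (F x)).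
    by move: xz => [_]; rewrite /eball/= /s; lra.
  have [z1 xz30] := near z xz; have [w1 xw30] := near w xw.
  by have [] := Fd z w z1 w1 xz30 xw30.
(* A point outside both sets would have [z] and [F z] in [I] with inner product [t] in [X]. *)
have capA : cap x s `<=` (eball x r `&` (S `\` I)) `|` A.
  move=> z xz; have [z1 xz30] := near z xz; have [Fz1 zFz] := F1 z z1 xz30.
  have [Iz|nIz] := pselect (I z).
    by right; split=> // IFz; apply: (XI z (F z)) => //; rewrite zFz.
  left; split; last by split.
  by case: xz => _; rewrite /eball/= /s; lra.
have fin z q : H (cap z q) \is a fin_num.
  by rewrite ge0_fin_numE ?hausdorff_ge0// (le_lt_trans (hausdorff_cap_sphere _ _ _)).
pose g := fine (H (cap x s)).
have gE : H (cap x s) = g%:E by rewrite fineK.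
have g0 : (0 < g)%R by rewrite -lte_fin -gE hausdorff_cap_gt0.
have capr z : S z -> H (cap z r) <= (D%:R * g)%:E.
  move=> z1; rewrite EFinM -gE; have := capD z x s z1 x1 s0.
  by rewrite /s mulrC divfK// pnatr_eq0.
have : H (cap x s) <= (c * (D%:R * g))%:E + (2 ^+ m.+1 * (c * (D%:R * g)))%:E.
  apply: le_trans (le_hausdorff m capA) _; apply: le_trans (outer_measureU2 _ _ _) _.
  have cD z : S z -> H (eball z r `&` (S `\` I)) <= c%:E * H (cap z r) ->
      H (eball z r `&` (S `\` I)) <= (c * (D%:R * g))%:E.
    by move=> z1 /le_trans; apply; rewrite EFinM; apply: lee_wpmul2l (capr z z1);
      rewrite lee_fin ltW.
  apply: leeD; first exact: cD.
  apply: le_trans HA _; rewrite EFinM; apply: lee_wpmul2l; last exact: cD.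
  by rewrite lee_fin exprn_ge0.
rewrite gE -EFinD lee_fin leNgt => /negP; apply.
rewrite -[X in (X + _)%R]mul1r -mulrDl -/L /c.
have -> : (L * ((D.+1%:R * L)^-1 * (D%:R * g)) = D%:R / D.+1%:R * g)%R.
  by field; rewrite (gt_eqF L0) nat1r pnatr_eq0.
by rewrite gtr_pMl// ltr_pdivrMr// mul1r ltr_nat.
Qed.

Lemma sphere_measure0 : @sphere_measure R m.+2 set0 = 0.
Proof. by rewrite /sphere_measure hausdorff0 mul0e. Qed.

Lemma alpha_ge0 X : 0 <= alpha m.+2 X.
Proof.
apply: ereal_sup_ubound; exists set0; last exact: sphere_measure0.
split; last by move=> x y [].
by split; [exact: sub0set|exact: caratheodory_measurable_set0].
Qed.

Lemma alpha_closure_le X : alpha m.+2 (closure X) <= alpha m.+2 X.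
Proof.
apply: ereal_sup_le => _ [A [mA XA] <-]; exists A => //; split=> // x y Ax Ay Xxy.
exact: XA x y Ax Ay (subset_closure Xxy).
Qed.

Lemma alpha_le_closure X : X `<=` `[(-1)%R, 1%R]%classic ->
  alpha m.+2 X <= alpha m.+2 (closure X).
Proof.
move=> X1; apply: ge_ereal_sup => _ [I [[IS mI] XI] <-].
(* [fine] sends [+oo] to 0 and the inverse of 0 is 0, so both degenerate cases give [I] measure
   0. *)
have degenerate : (fine (H S))^-1%R = 0%R -> sphere_measure I <= alpha m.+2 (closure X).
  by move=> h; rewrite /sphere_measure /= h mule0 alpha_ge0.
have [S0|S0] := eqVneq (H S) 0; first by rewrite degenerate// S0 invr0.
have [Soo|Soo] := eqVneq (H S) +oo; first by rewrite degenerate// Soo invr0.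
have {}S0 : 0 < H S by rewrite lt_def S0 hausdorff_ge0.
have {}Soo : H S < +oo by rewrite ltey.
pose K : R := (fine (H S))^-1%R.
have K0 : (0 < K)%R by rewrite invr_gt0 fine_gt0// S0.
have [c c0 cP] := exists_avoiding_density S0 Soo.
apply/lee_addgt0Pr => e e0.
(* The loss [e / K] becomes [e] after normalisation; 1/30 is the radius up to which the rotations
   are controlled. *)
have [r [J [r0 mJ JI IJ dens]]] :=
  @sphere_density R m.+2 m I c (e / K) (1 / 30) S0 Soo mI IS c0 (divr_gt0 e0 K0)
    (divr_gt0 ltr01 (ltr0Sn _ 29)).
have HK : H I * K%:E <= H J * K%:E + e%:E.
  apply: le_trans (lee_wpmul2r _ IJ) _; first by rewrite lee_fin ltW.
  rewrite ge0_muleDl ?hausdorff_ge0 ?lee_fin ?divr_ge0 ?(ltW e0) ?(ltW K0)//.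
  by rewrite -EFinM divfK ?gt_eqF.
apply: le_trans HK _; apply: leeD2r; apply: ereal_sup_ubound; exists J => //.
split; first by split=> //; exact: subset_trans IS.
move=> x y Jx Jy.
by apply: (cP X I r) => //; [exact/IS/JI|exact/IS/JI|exact: dens|exact: dens].
Qed.
End avoiding.

Theorem theorem17 (R : realType) (n : nat) (hn : (2 <= n)%N)
    (X : set R) (hX : X `<=` `[-1, 1]) :
  alpha n X = alpha n (closure X) /\
  (closure X 1 -> alpha n X = 0%E).
Proof.
case: n hn => [|[|m]] // _.
have XcX : alpha m.+2 X = alpha m.+2 (closure X).
  by apply/eqP; rewrite eq_le alpha_le_closure// alpha_closure_le.
split=> // X1; apply/eqP; rewrite eq_le alpha_ge0 andbT XcX.
apply: ge_ereal_sup => _ [A [[AS _] XA] <-].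
(* A point of [A] has inner product 1 with itself, and 1 is in the closure of [X]. *)
rewrite (_ : A = set0) ?sphere_measure0// -subset0 => x Ax.
by apply: (XA x x Ax Ax); rewrite (AS x Ax : dot x x = 1).
Qed.
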